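(* Let $\delta\ge 0$ and let $a(n)=an^\delta+\cdots$, $b(n)=bn^\delta+\cdots$, $c(n)=cn^\delta+\cdots$ be real polynomials in $n$ of degree $\delta$ with positive leading coefficients $a,b,c$, taking positive values for all integers $n\ge1$. Let $(u_n)_{n\ge 0}$ be a real sequence satisfying $$a(n)u_{n+1}=b(n)u_n-c(n)u_{n-1},\qquad n=1,2,\ldots. \quad ( * )$$ Put $\beta_n=b(n)/a(n)$ and $\gamma_n=c(n)/a(n)$ for $n\ge1$. (i) If $(u_n)$ is eventually sign-definite (i.e. there is $N$ such that either $u_n>0$ for all $n\ge N$ or $u_n<0$ for all $n\ge N$), then $b^2\ge 4ac$. (ii) If $u_n>0$ for all $n\ge 0$, then the continued fraction $$\cfrac{\gamma_1}{\beta_1-\cfrac{\gamma_2}{\beta_2-\cfrac{\gamma_3}{\beta_3-\cdots}}}$$ converges to a finite positive limit $\rho_0$, and $u_1\ge \rho_0u_0$. Moreover, the solution $(u^*_n)_{n\ge 0}$ of $( * )$ determined by $u^*_0=1$ and $u^*_1=\rho_0$ satisfies $u^*_n>0$ for all $n\ge0$ and is a minimal solution of $( * )$.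
   Context: A continued fraction converges if the sequence of its finite truncations (convergents) has a finite limit. A nontrivial (not identically zero) solution $(u^*_n)$ of $( * )$ is called minimal if $\lim_{n\to\infty}u^*_n/u_n=0$ for every solution $(u_n)$ of $( * )$ that is not a scalar multiple of $(u^*_n)$. *)

(* Defs.v *)
From HB Require Import structures.
From mathcomp Require Import all_boot all_order all_algebra.
From mathcomp Require Import all_classical all_reals all_analysis.

Set Implicit Arguments.
Unset Strict Implicit.
Unset Printing Implicit Defensive.

Import Order.TTheory GRing.Theory Num.Theory.
Import numFieldNormedType.Exports.

Local Open Scope classical_set_scope.
Local Open Scope ring_scope.

Definition is_solution (R : realType) (a b c : {poly R}) (u : nat -> R) : Prop :=
  forall n : nat, (1 <= n)%N ->
    a.[n%:R] * u n.+1 = b.[n%:R] * u n - c.[n%:R] * u n.-1.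

Definition eventually_sign_definite (R : realType) (u : nat -> R) : Prop :=
  exists N : nat, (forall n, (N <= n)%N -> 0 < u n) \/
                  (forall n, (N <= n)%N -> u n < 0).

(* Finite continued fraction with m levels starting at index k:
     gamma_k / (beta_k - gamma_(k+1) / (... - gamma_(k+m-1) / beta_(k+m-1))). *)
Fixpoint cf_trunc (R : realType) (beta gamma : nat -> R) (k m : nat) : R :=
  if m is m'.+1 then gamma k / (beta k - cf_trunc beta gamma k.+1 m') else 0.

Fixpoint cf_trunc_defined (R : realType) (beta gamma : nat -> R) (k m : nat)
    : Prop :=
  if m is m'.+1 then
    cf_trunc_defined beta gamma k.+1 m' /\
    beta k - cf_trunc beta gamma k.+1 m' != 0
  else True.

(* Since x / 0 = 0 here, convergence has to say explicitly that all but
   finitely many convergents contain no division by zero. *)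
Definition cf_converges_to (R : realType) (beta gamma : nat -> R) (l : R)
    : Prop :=
  (\forall n \near \oo, cf_trunc_defined beta gamma 1 n) /\
  cf_trunc beta gamma 1 n @[n --> \oo] --> l.

(* As above, the meaning of the quotients us n / u n (for large n) is made
   explicit by requiring u n != 0 eventually. *)
Definition is_minimal_solution (R : realType) (a b c : {poly R})
    (us : nat -> R) : Prop :=
  [/\ is_solution a b c us,
      exists n, us n != 0 &
      forall u : nat -> R, is_solution a b c u ->
        ~ (exists k : R, forall n, u n = k * us n) ->
        (\forall n \near \oo, u n != 0) /\
        us n / u n @[n --> \oo] --> (0 : R)].

(* Main.v *)
Require Import Defs.
From HB Require Import structures.
From mathcomp Require Import all_boot all_order all_algebra.
From mathcomp Require Import all_classical all_reals all_analysis.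
From mathcomp Require Import ring lra.
From mathcomp Require polyrcf.

Set Implicit Arguments.
Unset Strict Implicit.
Unset Printing Implicit Defensive.

Import Order.TTheory GRing.Theory Num.Theory.
Import numFieldNormedType.Exports.

Local Open Scope classical_set_scope.
Local Open Scope ring_scope.

(** In normalised form the recurrence reads
    [u (n+2) = beta (n+1) * u (n+1) - gamma (n+1) * u n].

    (i) For a positive solution, the ratios [r n = u (n+1) / u n] satisfy
    [r (n+1) = beta (n+1) - gamma (n+1) / r n], so they stay below a bound of
    [beta].  If [b^2 < 4ac], the quadratic [r^2 - beta r + gamma] is eventually
    bounded below by a positive constant, so [r] decreases by at least a fixed
    amount at each step and becomes negative.

    (ii) The ratios of a positive solution bound the truncations of the tails of
    the continued fraction, which increase, so the tails converge to limits
    [rho k], and the products of the [rho k] form the positive solution [us].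
    If [p] is the solution starting with [0, 1], then
    [us + (x - rho0) p] vanishes at index [n] when [x] is the truncation with
    [n - 1] levels; so [us n / p n] is the difference of [rho0] and this
    truncation, which tends to [0].  Every solution which is not a multiple of
    [us] is [k us + d p] with [d != 0]. *)

(** * Polynomials of equal degree at large integers *)

Section PolynomialsAtInfinity.
Variable R : realType.
Implicit Types p q a b c : {poly R}.

(** Stated with a degree bound and a coefficient so that it applies to linear combinations, whose
    exact degree need not be computed beforehand. *)
Lemma horner_pinfty_gt0 p d : (size p <= d.+1)%N -> 0 < p`_d ->
  \forall n \near \oo, 0 < p.[n%:R].
Proof.
move=> szp pd_gt0.
have szpE : size p = d.+1.
  apply/eqP; rewrite eqn_leq szp ltnNge; apply/negP => /leq_sizeP/(_ d (leqnn _)).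
  by move=> pd0; rewrite pd0 ltxx in pd_gt0.
have lead_gt0 : 0 < lead_coef p by rewrite lead_coefE szpE.
have [x xP] := polyrcf.poly_pinfty_gt_lc lead_gt0.
near=> n; apply: (lt_le_trans lead_gt0); apply: xP.
by near: n; exact: nbhs_infty_ger.
Unshelve. all: by end_near. Qed.

Lemma size_mul_same p q d : size p = d.+1 -> size q = d.+1 ->
  size (p * q) = d.*2.+1.
Proof.
move=> szp szq; rewrite size_mul -?size_poly_eq0 ?szp ?szq//.
by rewrite addSn addnS addnn.
Qed.

Lemma coef_mul_same p q d : size p = d.+1 -> size q = d.+1 ->
  (p * q)`_d.*2 = lead_coef p * lead_coef q.
Proof.
by move=> szp szq; rewrite -lead_coefM lead_coefE (size_mul_same szp szq).
Qed.

Lemma horner_ratio_bounded a b d : size a = d.+1 -> size b = d.+1 ->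
    0 < lead_coef a -> (forall n, (1 <= n)%N -> 0 < a.[n%:R]) ->
  exists M, \forall n \near \oo, b.[n%:R] / a.[n%:R] <= M.
Proof.
(* The [+ 1] makes the coefficient of [M *: a - b] in degree [d] equal to [lead_coef a]. *)
move=> sza szb la a_gt0; exists (lead_coef b / lead_coef a + 1).
set M := _ + 1.
have szp : (size (M *: a - b)%R <= d.+1)%N.
  rewrite (leq_trans (size_polyD _ _))// size_polyN geq_max szb leqnn andbT.
  by rewrite (leq_trans (size_scale_leq _ _))// sza.
have pd : (M *: a - b)`_d = lead_coef a.
  rewrite coefB coefZ.
  have -> : a`_d = lead_coef a by rewrite lead_coefE sza.
  have -> : b`_d = lead_coef b by rewrite lead_coefE szb.
  by rewrite /M; field; rewrite gt_eqF.
have := horner_pinfty_gt0 szp; rewrite pd => /(_ la) near_gt0.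
near=> n.
have n1 : (1 <= n)%N by near: n; exact: nbhs_infty_ge.
rewrite ler_pdivrMr ?a_gt0// -subr_ge0 ltW//.
have : 0 < (M *: a - b).[n%:R] by near: n.
by rewrite hornerD hornerN hornerZ.
Unshelve. all: by end_near. Qed.

Lemma discriminant_ratio_lt a b c d : size a = d.+1 -> size b = d.+1 ->
    size c = d.+1 -> 0 < lead_coef a ->
    (forall n, (1 <= n)%N -> 0 < a.[n%:R]) ->
    lead_coef b ^+ 2 < 4 * lead_coef a * lead_coef c ->
  exists2 e, 0 < e & \forall n \near \oo,
    (b.[n%:R] / a.[n%:R]) ^+ 2 + e <= 4 * (c.[n%:R] / a.[n%:R]).
Proof.
move=> sza szb szc la a_gt0 disc.
pose D := 4 * lead_coef a * lead_coef c - lead_coef b ^+ 2.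
have D_gt0 : 0 < D by rewrite subr_gt0.
have a0 : lead_coef a != 0 by rewrite gt_eqF.
(* Half of the limit of [4 gamma - beta^2], so that the top coefficient of [P] below is [D / 2]. *)
pose e := D / (2 * lead_coef a ^+ 2).
exists e; first by rewrite divr_gt0// mulr_gt0// exprn_gt0.
pose P := 4 *: (a * c) - b * b - e *: (a * a).
have szP : (size P <= d.*2.+1)%N.
  rewrite (leq_trans (size_polyD _ _))// geq_max size_polyN.
  rewrite (leq_trans (size_polyD _ _)) ?geq_max ?size_polyN.
    by rewrite (leq_trans (size_scale_leq _ _)) ?(size_mul_same sza sza).
  rewrite (leq_trans (size_scale_leq _ _)) ?(size_mul_same sza szc)//.
  by rewrite (size_mul_same szb szb) ltnSn.
have PdE : P`_d.*2 = D / 2.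
  rewrite !coefB !coefZ (coef_mul_same sza szc) (coef_mul_same szb szb).
  by rewrite (coef_mul_same sza sza) /e /D; field.
have := horner_pinfty_gt0 szP; rewrite PdE divr_gt0// => /(_ isT) near_gt0.
near=> n.
have n1 : (1 <= n)%N by near: n; exact: nbhs_infty_ge.
have an_gt0 := a_gt0 n n1.
have : 0 < P.[n%:R] by near: n.
rewrite !(hornerD, hornerN, hornerZ, hornerM) => Pn.
rewrite -subr_ge0.
have -> : 4 * (c.[n%:R] / a.[n%:R]) - ((b.[n%:R] / a.[n%:R]) ^+ 2 + e) =
   (4 * (a.[n%:R] * c.[n%:R]) - b.[n%:R] * b.[n%:R] - e * (a.[n%:R] * a.[n%:R]))
     / a.[n%:R] ^+ 2 by field; rewrite gt_eqF.
by rewrite divr_ge0 ?exprn_ge0// ltW.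
Unshelve. all: by end_near. Qed.

End PolynomialsAtInfinity.

(** * The normalised recurrence and its link with truncations *)

Section Recurrence.
Variables (R : realType) (beta gamma : nat -> R).
Implicit Types u v w us p : nat -> R.

Definition recurrent u := forall n,
  u n.+2 = beta n.+1 * u n.+1 - gamma n.+1 * u n.

Fixpoint recurrent_pair (x y : R) n : R * R :=
  if n is m.+1 then
    let: (s, t) := recurrent_pair x y m in (t, beta m.+1 * t - gamma m.+1 * s)
  else (x, y).

Definition recurrent_from x y n := (recurrent_pair x y n).1.

Lemma recurrent_fromP x y : recurrent (recurrent_from x y).
Proof. by move=> n; rewrite /recurrent_from /=; case: recurrent_pair. Qed.

Lemma recurrent_uniq u v : recurrent u -> recurrent v ->
  u 0 = v 0 -> u 1%N = v 1%N -> u =1 v.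
Proof.
move=> ru rv e0 e1 n.
suff [] : u n = v n /\ u n.+1 = v n.+1 by [].
by elim: n => [|n [en enS]]; split; rewrite ?ru ?rv ?en ?enS.
Qed.

Lemma recurrentD_mull k l u v : recurrent u -> recurrent v ->
  recurrent (fun n => k * u n + l * v n).
Proof. by move=> ru rv n; rewrite ru rv; ring. Qed.

Lemma recurrentN u : recurrent u -> recurrent (fun n => - u n).
Proof. by move=> ru n; rewrite ru; ring. Qed.

Lemma no_eventually_pos_recurrent u M e : recurrent u ->
    (\forall n \near \oo, 0 < u n) -> 0 < e ->
    (\forall n \near \oo, beta n <= M) ->
    (\forall n \near \oo, beta n ^+ 2 + e <= 4 * gamma n) ->
  False.
Proof.
move=> ru u_gt0 e_gt0 beta_le disc.
have [N _ NP] : \forall n \near \oo,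
    [/\ 0 < u n, beta n <= M & beta n ^+ 2 + e <= 4 * gamma n].
  by near=> n; split; near: n.
(* Starting at index [N.+1] makes the recurrence for the numerator involve only terms known to be
   positive, whence [r n < M]. *)
pose r n := u (N + n).+2 / u (N + n).+1.
have uN_gt0 n : 0 < u (N + n)%N by have [] := NP _ (leq_addr n N).
have uNS_gt0 n : 0 < u (N + n).+1 by rewrite -addnS.
have r_gt0 n : 0 < r n by rewrite divr_gt0// -addnS.
have gamma_gt0 n : 0 < gamma (N + n)%N.
  by have [_ _] := NP _ (leq_addr n N); nra.
have r_lt n : r n < M.
  have [_ + _] := NP _ (leq_addr n.+1 N); rewrite addnS; apply: lt_le_trans.
  rewrite ltr_pdivrMr// ru ltrBlDr ltrDl mulr_gt0//.
  by rewrite -addnS.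
have M_gt0 : 0 < M by exact: lt_trans (r_lt 0).
(* Completing the square, [r - beta + gamma / r] is [((2 r - beta)^2 + 4 gamma - beta^2) / (4 r)],
   hence at least [e / (4 r)], and [r < M] makes this uniform. *)
have r_dec n : r n.+1 <= r n - e / (4 * M).
  have rE : r n.+1 = beta (N + n).+2 - gamma (N + n).+2 / r n.
    rewrite /r addnS ru; field.
    by rewrite -?addnS !gt_eqF.
  have [_ _] := NP _ (leq_addr n.+2 N); rewrite !addnS => dn.
  rewrite rE; move: (beta _) (gamma _) (r n) (r_gt0 n) (r_lt n) dn.
  move=> B G s s_gt0 s_lt dn.
  have s4_gt0 : 0 < 4 * s by rewrite mulr_gt0.
  have step : e / (4 * M) <= e / (4 * s).
    rewrite ler_pM2l// lef_pV2 ?posrE//; last by rewrite mulr_gt0.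
    by rewrite ler_pM2l// ltW.
  have : 0 <= (4 * s ^+ 2 - 4 * B * s + 4 * G - e) / (4 * s).
    rewrite divr_ge0 ?(ltW s4_gt0)//.
    by have := sqr_ge0 (2 * s - B); nra.
  have -> : (4 * s ^+ 2 - 4 * B * s + 4 * G - e) / (4 * s) =
     s - B + G / s - e / (4 * s) by field; rewrite gt_eqF.
  by lra.
have r_le n : r n <= r 0 - n%:R * (e / (4 * M)).
  elim: n => [|n IH]; first by rewrite mul0r subr0.
  by rewrite -natr1 mulrDl mul1r; have := r_dec n; lra.
have eM_gt0 : 0 < e / (4 * M) by rewrite divr_gt0// mulr_gt0.
have /archi_boundP : 0 <= r 0 / (e / (4 * M)) by rewrite divr_ge0 ?ltW.
rewrite ltr_pdivrMr// => big.
have := r_le (Num.bound (r 0 / (e / (4 * M)))).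
have := r_gt0 (Num.bound (r 0 / (e / (4 * M)))).
by lra.
Unshelve. all: by end_near. Qed.

(** The recurrence carries the relation to the next index with one level fewer; the empty truncation
    is [0], so the last term reached vanishes. *)
Lemma recurrent_cf_trunc_eq0 u k m :
    cf_trunc_defined beta gamma k.+1 m -> recurrent u ->
  u k.+1 = cf_trunc beta gamma k.+1 m * u k -> u (k.+1 + m)%N = 0.
Proof.
move=> + ru; elim: m k => [|m IH] k /=; first by rewrite mul0r addn0.
move=> [def_m den_neq0] uk; rewrite addnS -addSn; apply: IH => //.
rewrite ru uk; field.
exact: den_neq0.
Qed.

(** * Convergence of the tails, given a positive solution *)

Section PositiveSolution.
Variable u : nat -> R.
Hypotheses (ru : recurrent u) (u_gt0 : forall n, 0 < u n).
Hypothesis gamma_gt0 : forall n, 0 < gamma n.+1.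

Let x k m := cf_trunc beta gamma k.+1 m.

Lemma recurrent_ratio k : u k.+2 / u k.+1 = beta k.+1 - gamma k.+1 / (u k.+1 / u k).
Proof. by rewrite ru; field; rewrite !gt_eqF. Qed.

Lemma lt_ratio_beta k : u k.+2 / u k.+1 < beta k.+1.
Proof. by rewrite recurrent_ratio ltrBlDr ltrDl !divr_gt0. Qed.

(** The map [t -> gamma k.+1 / (beta k.+1 - t)] increases for [t < beta k.+1] and sends the ratio at
    [k.+1] to the ratio at [k]. *)
Lemma cf_trunc_ratio_bound m k : 0 <= x k m <= u k.+1 / u k.
Proof.
elim: m k => [|m IH] k; first by rewrite /x /= lexx divr_ge0 ?ltW.
rewrite /x /= -/(x k.+1 m).
have /andP[x_ge0 x_le] := IH k.+1.
have den_gt0 : 0 < beta k.+1 - x k.+1 m.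
  by rewrite subr_gt0 (le_lt_trans x_le) ?lt_ratio_beta.
rewrite divr_ge0 ?(ltW den_gt0) ?(ltW (gamma_gt0 _))//=.
rewrite ler_pdivrMr// -ler_pdivrMl ?divr_gt0// mulrC.
by move: x_le; rewrite recurrent_ratio; lra.
Qed.

Lemma cf_trunc_denominator_gt0 k m : 0 < beta k.+1 - x k.+1 m.
Proof.
have /andP[_ x_le] := cf_trunc_ratio_bound m k.+1.
by rewrite subr_gt0 (le_lt_trans x_le) ?lt_ratio_beta.
Qed.

Lemma cf_trunc_defined_pos m k : cf_trunc_defined beta gamma k.+1 m.
Proof.
elim: m k => [//|m IH] k /=; split; first exact: IH.
by rewrite gt_eqF// cf_trunc_denominator_gt0.
Qed.

(** The same increasing map reduces the comparison to the next tail with one level fewer, down to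
    [0 <= x k 1]. *)
Lemma cf_trunc_nondecreasing k : nondecreasing_seq (x k).
Proof.
apply/nondecreasing_seqP => m; elim: m k => [|m IH] k.
  by have /andP[] := cf_trunc_ratio_bound 1 k.
have xS n : x k n.+1 = gamma k.+1 / (beta k.+1 - x k.+1 n) by [].
rewrite !xS ler_pM2l// lef_pV2 ?posrE ?cf_trunc_denominator_gt0//.
by rewrite lerB.
Qed.

Definition cf_tail k := limn (x k).

Lemma cf_tail_cvg k : x k @ \oo --> cf_tail k.
Proof.
apply: nondecreasing_is_cvgn; first exact: cf_trunc_nondecreasing.
exists (u k.+1 / u k) => _ [m _ <-].
by have /andP[] := cf_trunc_ratio_bound m k.
Qed.

Lemma cf_trunc_le_tail k m : x k m <= cf_tail k.
Proof.
apply: nondecreasing_cvgn_le; first exact: cf_trunc_nondecreasing.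
exact: cvgP (@cf_tail_cvg k).
Qed.

Lemma cf_tail_gt0 k : 0 < cf_tail k.
Proof.
apply: lt_le_trans (cf_trunc_le_tail k 1).
by rewrite /x /= divr_gt0// (cf_trunc_denominator_gt0 k 0).
Qed.

Lemma cf_tail_le_ratio k : cf_tail k <= u k.+1 / u k.
Proof.
apply: (cvgr_to_le (@cf_tail_cvg k)); near=> m.
by have /andP[] := cf_trunc_ratio_bound m k.
Unshelve. all: by end_near. Qed.

(** In product form the limit can be taken before the limiting denominator is known to be
    nonzero. *)
Lemma cf_tail_rec k : cf_tail k * (beta k.+1 - cf_tail k.+1) = gamma k.+1.
Proof.
have xS : x k m.+1 @[m --> \oo] --> cf_tail k.
  by rewrite (cvg_shiftS (x k)); exact: cf_tail_cvg.
have den : beta k.+1 - x k.+1 m @[m --> \oo] --> beta k.+1 - cf_tail k.+1.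
  by apply: cvgB; [exact: cvg_cst|exact: cf_tail_cvg].
apply: (cvg_unique _ (cvgM xS den)) => //.
rewrite (_ : _ \* _ = cst (gamma k.+1)); first exact: cvg_cst.
apply/funext => m; rewrite /x /= -/(x k.+1 m) mulfVK//.
by rewrite gt_eqF// cf_trunc_denominator_gt0.
Qed.

(** * Positivity and minimality of the solution built from the tails *)

Section MinimalSolution.
Variable us : nat -> R.
Hypotheses (rus : recurrent us) (us0 : us 0 = 1) (us1 : us 1%N = cf_tail 0).

Lemma recurrent_cf_tail k : us k.+1 = cf_tail k * us k.
Proof.
elim: k => [|k IH]; first by rewrite us0 mulr1.
by rewrite rus IH -[gamma k.+1](cf_tail_rec k); ring.
Qed.

Lemma recurrent_cf_tail_gt0 k : 0 < us k.
Proof.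
elim: k => [|k IH]; first by rewrite us0.
by rewrite recurrent_cf_tail mulr_gt0 ?cf_tail_gt0.
Qed.

Let p := recurrent_from 0 1.

Lemma recurrent_cf_trunc_error m : us m.+1 = (cf_tail 0 - x 0 m) * p m.+1.
Proof.
(* This solution starts with [1] and [x 0 m], so it vanishes at index [m.+1]. *)
have rw : recurrent (fun n => 1 * us n + (x 0 m - cf_tail 0) * p n).
  by apply: recurrentD_mull => //; exact: recurrent_fromP.
have := recurrent_cf_trunc_eq0 (@cf_trunc_defined_pos m 0) rw.
rewrite add1n us0 us1 /p /= => w_eq0.
have /w_eq0 : 1 * cf_tail 0 + (x 0 m - cf_tail 0) * recurrent_from 0 1 1 =
    cf_trunc beta gamma 1 m * (1 * 1 + (x 0 m - cf_tail 0) * recurrent_from 0 1 0).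
  by rewrite /recurrent_from /= -/(x 0 m); ring.
by move=> /eqP; rewrite mul1r addr_eq0 => /eqP ->; ring.
Qed.

Lemma recurrent_cf_tail_minimal v : recurrent v ->
    ~ (exists k, forall n, v n = k * us n) ->
  (\forall n \near \oo, v n != 0) /\ us n / v n @[n --> \oo] --> (0 : R).
Proof.
(* The coordinates of [v] in the basis [us], [p] are [v 0] and [d], read off at indices 0 and 1. *)
move=> rv v_indep; pose d := v 1%N - v 0 * cf_tail 0.
have vE n : v n = v 0 * us n + d * p n.
  move: n; apply: recurrent_uniq => //.
  - by apply: recurrentD_mull => //; exact: recurrent_fromP.
  - by rewrite us0 /p /recurrent_from /=; ring.
  - by rewrite us1 /p /recurrent_from /d /=; ring.
have d_neq0 : d != 0.
  apply/eqP => d0; apply: v_indep; exists (v 0) => n.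
  by rewrite [LHS]vE d0 mul0r addr0.
have p_neq0 n : p n.+1 != 0.
  apply/eqP => pn0; have := recurrent_cf_tail_gt0 n.+1.
  by rewrite recurrent_cf_trunc_error pn0 mulr0 ltxx.
pose y n := cf_tail 0 - x 0 n.
have y_cvg : y n @[n --> \oo] --> (0 : R).
  rewrite -(subrr (cf_tail 0)); apply: cvgB; first exact: cvg_cst.
  exact: cf_tail_cvg.
(* This sequence is [v n.+1 / p n.+1]; its nonzero limit gives both the eventual nonvanishing of [v]
   and the limit of the quotient. *)
have vp_cvg : v 0 * y n + d @[n --> \oo] --> d.
  have : v 0 * y n + d @[n --> \oo] --> v 0 * 0 + d.
    by apply: cvgD; [exact: cvgMl_tmp|exact: cvg_cst].
  by rewrite mulr0 add0r.
have vSE n : v n.+1 = (v 0 * y n + d) * p n.+1.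
  by rewrite [LHS]vE recurrent_cf_trunc_error -/(y n); ring.
split.
  have [N _ NP] := cvgr_neq0 _ vp_cvg d_neq0.
  exists N.+1 => // -[//|n] /= Nn.
  by rewrite vSE mulf_neq0//; exact: NP.
rewrite -(cvg_shiftS (fun n => us n / v n)).
rewrite (_ : [sequence _]_n = (fun n => y n * (v 0 * y n + d)^-1)).
  have : y n * (v 0 * y n + d)^-1 @[n --> \oo] --> 0 * d^-1.
    by apply: cvgM => //; exact: cvgV.
  by rewrite mul0r.
apply/funext => n /=; rewrite recurrent_cf_trunc_error vSE -/(y n).
by rewrite invfM mulrACA divff// mulr1.
Qed.

End MinimalSolution.
End PositiveSolution.
End Recurrence.

(** * Return to polynomial coefficients *)

Lemma is_solution_recurrent (R : realType) (a b c : {poly R}) (u : nat -> R) :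
    (forall n : nat, (1 <= n)%N -> 0 < a.[n%:R]) ->
  is_solution a b c u <-> recurrent (fun n => b.[n%:R] / a.[n%:R])
                                    (fun n => c.[n%:R] / a.[n%:R]) u.
Proof.
move=> a_gt0; split=> [su n|ru [//|n] _].
  have an0 : a.[n.+1%:R] != 0 by rewrite gt_eqF ?a_gt0.
  apply: (mulfI an0); rewrite su//=; field.
  exact: an0.
rewrite ru /=; field.
by rewrite gt_eqF ?a_gt0.
Qed.

Theorem theorem1p2 (R : realType) (delta : nat) (a b c : {poly R})
    (size_a : size a = delta.+1) (size_b : size b = delta.+1)
    (size_c : size c = delta.+1)
    (lead_a : 0 < lead_coef a) (lead_b : 0 < lead_coef b)
    (lead_c : 0 < lead_coef c)
    (a_pos : forall n : nat, (1 <= n)%N -> 0 < a.[n%:R])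
    (b_pos : forall n : nat, (1 <= n)%N -> 0 < b.[n%:R])
    (c_pos : forall n : nat, (1 <= n)%N -> 0 < c.[n%:R])
    (u : nat -> R) (u_sol : is_solution a b c u) :
  let beta := fun n : nat => b.[n%:R] / a.[n%:R] in
  let gamma := fun n : nat => c.[n%:R] / a.[n%:R] in
  (eventually_sign_definite u ->
     4 * lead_coef a * lead_coef c <= lead_coef b ^+ 2) /\
  ((forall n : nat, 0 < u n) ->
     exists rho0 : R,
       [/\ 0 < rho0,
           cf_converges_to beta gamma rho0,
           rho0 * u 0%N <= u 1%N,
           (exists us : nat -> R,
              [/\ is_solution a b c us, us 0%N = 1 & us 1%N = rho0]) &
           forall us : nat -> R, is_solution a b c us ->
             us 0%N = 1 -> us 1%N = rho0 ->
             (forall n : nat, 0 < us n) /\ is_minimal_solution a b c us]).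
Proof.
move=> beta gamma.
have solP v := is_solution_recurrent b c v a_pos.
have ru : recurrent beta gamma u by apply/solP.
split=> [[N Nsgn]|u_gt0].
  rewrite leNgt; apply/negP => disc.
  have [M beta_le] := horner_ratio_bounded size_a size_b lead_a a_pos.
  have [e e_gt0 disc_le] :=
    discriminant_ratio_lt size_a size_b size_c lead_a a_pos disc.
  case: Nsgn => sgn.
    by apply: (no_eventually_pos_recurrent ru _ e_gt0 beta_le disc_le); exists N.
  apply: (no_eventually_pos_recurrent (recurrentN ru) _ e_gt0 beta_le disc_le).
  by exists N => // n Nn /=; rewrite oppr_gt0 sgn.
have gamma_gt0 n : 0 < gamma n.+1 by rewrite divr_gt0 ?c_pos ?a_pos.
exists (cf_tail beta gamma 0); split.
- exact: cf_tail_gt0 ru u_gt0 gamma_gt0 0.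
- split; first by exists 0 => // n _; exact: cf_trunc_defined_pos ru u_gt0 gamma_gt0 n 0.
  exact: cf_tail_cvg ru u_gt0 gamma_gt0 0.
- by rewrite -ler_pdivlMr ?u_gt0//; exact: cf_tail_le_ratio ru u_gt0 gamma_gt0 0.
- exists (recurrent_from beta gamma 1 (cf_tail beta gamma 0)); split=> //.
  by apply/solP; exact: recurrent_fromP.
move=> us sus us0 us1; have rus : recurrent beta gamma us by apply/solP.
have us_gt0 := recurrent_cf_tail_gt0 ru u_gt0 gamma_gt0 rus us0 us1.
split=> //; split=> //; first by exists 0; rewrite us0 oner_neq0.
move=> v /solP rv; exact: recurrent_cf_tail_minimal ru u_gt0 gamma_gt0 us rus us0 us1 v rv.
Qed.
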